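(* For every $\delta\in[1,2]$ and every $\ell\in\{3,4,5,\ldots\}\cup\{\infty\}$, $$\alpha_\star(\delta,\ell)\ \le\ 1+\sqrt{1-\frac{(2-\delta)^2}{4\gamma(\ell)}}.$$ Furthermore, for $\ell=2$ the same estimate $\alpha_\star(\delta,2)\le 1+\sqrt{1-\frac{(2-\delta)^2}{4\gamma(2)}}$ holds for every $\delta\in[6/5,2]$, and $\alpha_\star(\delta,2)\le 4\delta/3$ for every $\delta\in[1,6/5]$.
   Context: $\log$ denotes the base 2 logarithm, and $G(n,1/2)$ is the Erdős–Rényi random graph on $n$ labelled vertices in which every pair is an edge independently with probability $1/2$. Adaptive query algorithms. An algorithm knows $n$ and interacts with a hidden $G\sim G(n,1/2)$ only by querying pairs of vertices; a query reveals whether the pair is an edge of $G$. Computation time is unlimited; only queries are counted. For $\ell\in\mathbb N$, an $\ell$-adaptive algorithm makes its queries in $\ell$ rounds: all queries of a round are made simultaneously, and their choice may depend only on the answers received in previous rounds. For $\ell=\infty$ the algorithm is fully adaptive (each query may depend on the answers to all previous queries, with no bound on the number of rounds). ''With high probability'' means with probability tending to $1$ as $n\to\infty$. $\alpha_\star(\delta,\ell)$ is the supremum of all $\alpha$ for which there is an $\ell$-adaptive algorithm that makes at most $n^\delta$ queries in total and outputs, with high probability, a clique of $G\sim G(n,1/2)$ of size $\alpha\log n$ (up to rounding to an integer). Definition of $\gamma(\ell)$, $\ell\in\mathbb N\cup\{\infty\}$. Let $M,N\in\mathbb N$ with $N\ge 2M$, let $\lambda:E(K_N)\to\{1,\ldots,\ell\}$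 be a labeling of the edges of the complete graph $K_N$ (for $\ell=\infty$, labels are arbitrary positive integers), and let $\mathcal M$ be a matching in $K_N$ with $M$ edges. An edge $uv$ of $K_N$ is critical if there is an edge $e\in\mathcal M$ covering $u$ or $v$ (i.e. incident to $u$ or to $v$) with $\lambda(uv)<\lambda(e)$. Let $\gamma(\ell,M,N,\lambda,\mathcal M)$ be the number of critical edges divided by $\binom{2M}{2}$. Then $$\gamma(\ell)=\limsup_{M\to\infty}\ \max_{N\ge 2M}\ \max_{\lambda}\ \min_{\mathcal M}\ \gamma(\ell,M,N,\lambda,\mathcal M),$$ where $\lambda$ ranges over all such labelings and $\mathcal M$ over all matchings of size $M$ in $K_N$. *)

(* Defs.v *)
From HB Require Import structures.
From mathcomp Require Import all_boot all_order all_algebra.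
From mathcomp Require Import all_classical all_reals all_analysis.

Set Implicit Arguments.
Unset Strict Implicit.
Unset Printing Implicit Defensive.

Import Order.TTheory GRing.Theory Num.Theory.
Import numFieldNormedType.Exports.

Local Open Scope classical_set_scope.
Local Open Scope ring_scope.

(* An element of N u {oo}; [None] stands for oo. *)
Definition enat := option nat.

Definition le_enat (k : nat) (l : enat) : bool :=
  if l is Some b then (k <= b)%N else true.

(* Unordered pairs of distinct vertices, i.e. the edges of K_n.  A graph on n
   labelled vertices is the set of its edges, an element of [{set edge n}]. *)
Definition edge (n : nat) := {e : {set 'I_n} | #|e| == 2%N}.

Definition is_clique (n : nat) (G : {set edge n}) (S : {set 'I_n}) : bool :=
  [forall e : edge n, (val e \subset S) ==> (e \in G)].

(* Probability of the event E under G(n, p). *)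
Definition gnp_prob (R : realType) (n : nat) (p : R) (E : pred {set edge n}) : R :=
  \sum_(G : {set edge n} | E G)
    \prod_(e : edge n) (if e \in G then p else 1 - p).

(* A deterministic adaptive algorithm.  The argument of [query] and [output] is
   the list, round by round, of the set of queried pairs that turned out to be
   edges; since the algorithm is deterministic, this list also determines which
   pairs were queried, and hence all the answers received so far. *)
Record algorithm (n : nat) := Algorithm {
  rounds : nat;
  query : seq {set edge n} -> {set edge n};
  output : seq {set edge n} -> {set 'I_n}
}.

Fixpoint answers (n : nat) (A : algorithm n) (G : {set edge n}) (r : nat) :
    seq {set edge n} :=
  if r is r'.+1 then
    let h := answers A G r' in rcons h (query A h :&: G)%SET
  else [::].

Definition num_queries (n : nat) (A : algorithm n) (G : {set edge n}) : nat :=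
  (\sum_(r < rounds A) #|query A (answers A G r)|)%N.

Definition result (n : nat) (A : algorithm n) (G : {set edge n}) : {set 'I_n} :=
  output A (answers A G (rounds A)).

Definition log2 (R : realType) (x : R) : R := ln x / ln 2.

Definition finds_clique (R : realType) (alpha : R) (n : nat) (A : algorithm n)
    (G : {set edge n}) : bool :=
  is_clique G (result A G) &&
  ((#|result A G|)%:Z == Num.floor (alpha * log2 (n%:R : R))).

(* For l = oo the number of rounds is an arbitrary function of n.  Rounds with a
   single query give the fully adaptive algorithms: an algorithm making at most
   n ^ delta queries has a bounded number of nonempty rounds for each n, and
   empty rounds are allowed. *)
Definition achievable (R : realType) (delta : R) (l : enat) (alpha : R) : Prop :=
  exists A : forall n : nat, algorithm n,
    [/\ forall n : nat, le_enat (rounds (A n)) l,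
        forall (n : nat) (G : {set edge n}),
          (num_queries (A n) G)%:R <= (n%:R : R) `^ delta
      & (fun n : nat => gnp_prob (2^-1 : R) (finds_clique alpha (A n))) @ \oo
          --> (1 : R)].

Definition alpha_star (R : realType) (delta : R) (l : enat) : \bar R :=
  ereal_sup [set alpha%:E | alpha in [set alpha : R | achievable delta l alpha]].

Definition labeling (l : enat) (N : nat) (lam : edge N -> nat) : Prop :=
  forall e : edge N, (1 <= lam e)%N /\ le_enat (lam e) l.

Definition matching (N : nat) (m : {set edge N}) : bool :=
  finset.trivIset [set val e | e in m]%SET.

Definition critical (N : nat) (lam : edge N -> nat) (m : {set edge N})
    (f : edge N) : bool :=
  [exists e in m, ~~ [disjoint val e & val f] && (lam f < lam e)%N].

Definition critical_ratio (R : realType) (M N : nat) (lam : edge N -> nat)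
    (m : {set edge N}) : R :=
  #|[set f : edge N | critical lam m f]%SET|%:R / 'C(2 * M, 2)%:R.

Definition min_ratio (R : realType) (M N : nat) (lam : edge N -> nat) : \bar R :=
  ereal_inf [set (critical_ratio R M lam m)%:E |
    m in [set m : {set edge N} | matching m /\ #|m| = M]].

(* The maximum over N >= 2M and over all labelings is written as a supremum in
   the extended reals.  It is attained: if the matching is chosen greedily by
   increasing label, every critical edge has both ends covered, so that the
   minimum over matchings is at most 1 and lies in a fixed finite set. *)
Definition max_min_ratio (R : realType) (l : enat) (M : nat) : \bar R :=
  ereal_sup [set x : \bar R | exists (N : nat) (lam : edge N -> nat),
    [/\ (2 * M <= N)%N, labeling l lam & x = min_ratio R M lam]].

(* By the bound above the limsup lies in [0, 1] for l >= 1, so [fine] loses nothing. *)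
Definition gamma (R : realType) (l : enat) : R :=
  fine (limn_esup (max_min_ratio R l)).

(* Main.v *)
Require Import Defs.
From mathcomp Require Import all_boot all_order all_algebra.
From mathcomp Require Import all_classical all_reals all_analysis.
From mathcomp Require Import fintype finset zify ring lra.

Set Implicit Arguments.
Unset Strict Implicit.
Unset Printing Implicit Defensive.

Import Order.TTheory GRing.Theory Num.Theory.
Import numFieldNormedType.Exports.

(** Suppose that an algorithm succeeds with a clique S on N = alpha log n
    vertices with probability close to 1.  Then, again with high probability, every
    pair inside S has been queried: an unqueried pair of the output is an edge with
    conditional probability only one half ([unqueried_half]).  Label each pair of S
    by the round that queried it first.  For every M <= N / 2, the definition
    of gamma gives a matching of M pairs of S with at most about
    gamma (2 M)^2 / 2 critical pairs ([gamma_matching]).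

    The proof is a union bound over the ways to locate S.  The 2 M matched
    vertices are located by the positions of the matching pairs in the list of
    all queries, which leaves (n^delta)^M choices instead of n^(2 M); the other
    N - 2 M vertices are listed outright.  Fix such a code.  When a pair uv is
    queried in a round at least as late as the matching pairs at u and v, the
    code and the past answers already tell that uv lies in S, so the answer is
    a fair coin that has to come up edge.  The pairs for which this fails are
    exactly the critical ones.  A supermartingale argument
    ([settled_weight]) turns this into the bound 2^(- noncritical pairs) on the
    probability that a given code describes a clique, whence
    ([card_good_graphs], [success_bound])
      delta M + N - 2 M >= (N^2 / 2 - 2 gamma M^2) / log n + o(log n).
    With M = mu log n this reads ([achievable_quadratic_closed])
      alpha^2 / 2 - alpha - 2 gamma mu^2 + (2 - delta) mu <= 0
    for all 0 <= mu <= alpha / 2.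

    The left side is largest at mu = (2 - delta) / (4 gamma), where the
    inequality is the one with the square root.  That this mu is at most
    alpha / 2 needs lower bounds on gamma: 1/3 for at least three rounds and
    1/4 for two, both coming from labelings by nested hubs ([gamma_ge]).  For
    two rounds and delta <= 6/5 the optimum leaves the admissible range, and
    the end point mu = alpha / 2 is used together with the upper bound
    gamma(2) <= 1/4 ([gamma2_le]), an augmenting-path argument. *)

(** * Matchings and critical edges *)

Section Matchings.
Local Open Scope set_scope.
Variable N : nat.
Implicit Types (e f g : edge N) (m : {set edge N}) (X : {set 'I_N}).

Lemma edge_of_pair (u v : 'I_N) : u != v -> exists e, val e = [set u; v].
Proof.
move=> uv; have h : #|[set u; v]| == 2 by rewrite cards2 uv.
by exists (exist _ [set u; v] h).
Qed.

Lemma edge_ends e : exists u v, u != v /\ val e = [set u; v].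
Proof. by have /cards2P[u [v [uv ->]]] := valP e; exists u, v. Qed.

Lemma card_edge : #|{: edge N}| = 'C(N, 2).
Proof.
have := card_draws 'I_N 2; rewrite card_ord card_sig => <-.
by apply: eq_card => X; rewrite !inE.
Qed.

Definition covered m : {set 'I_N} := \bigcup_(e in m) val e.

Lemma coveredP m v : reflect (exists2 e, e \in m & v \in val e) (v \in covered m).
Proof. exact: bigcupP. Qed.

Lemma matchingP m :
  reflect {in m &, forall e f, e != f -> [disjoint val e & val f]} (matching m).
Proof.
apply: (iffP trivIsetP) => [h e f em fm ef|h _ _ /imsetP[e em ->] /imsetP[f fm ->]].
  by apply: h; rewrite ?imset_f // (inj_eq val_inj).
by rewrite (inj_eq val_inj); exact: h.
Qed.

Lemma card_covered m : matching m -> #|covered m| = 2 * #|m|.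
Proof.
move=> mm.
have -> : covered m = finset.cover [set val e | e in m].
  by rewrite /finset.cover big_imset //= => ? ? _ _; exact: val_inj.
have /eqP <- : \sum_(A in [set val e | e in m]) #|A| == #|finset.cover [set val e | e in m]| := mm.
rewrite big_imset /=; last by move=> ? ? _ _; exact: val_inj.
rewrite (eq_bigr (fun=> 2)); last by move=> e _; exact/eqP/(valP e).
by rewrite sum_nat_const mulnC.
Qed.

Lemma matching_setU m m' : matching m -> matching m' ->
  [disjoint covered m & covered m'] -> matching (m :|: m') /\ #|m :|: m'| = #|m| + #|m'|.
Proof.
move=> /matchingP mm /matchingP mm' dis.
have D e f : e \in m -> f \in m' -> [disjoint val e & val f].
  by move=> em fm; apply: disjointW dis; apply: bigcup_sup.
split.
  apply/matchingP => e f /setUP[em|em] /setUP[fm|fm] ef.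
  - exact: mm.
  - exact: D.
  - by rewrite disjoint_sym; exact: D.
  - exact: mm'.
rewrite cardsU; suff -> : m :&: m' = set0 by rewrite cards0 subn0.
apply/setP => e; rewrite !inE; apply/negP => /andP[em em'].
have := D e e em em'; rewrite -setI_eq0 setIid -cards_eq0.
by rewrite (eqP (valP e)).
Qed.

Lemma covered1 e : covered [set e] = val e.
Proof. by rewrite /covered big_set1. Qed.

Lemma coveredU m m' : covered (m :|: m') = covered m :|: covered m'.
Proof. by rewrite /covered bigcup_setU. Qed.

Lemma matching_set1 e : matching [set e].
Proof. by apply/matchingP => f g /set1P-> /set1P->; rewrite eqxx. Qed.

(** The next matching edge is an edge of least label among those avoiding the
    set X of vertices used so far.  An edge f with a smaller label than a matching
    edge e at one of its ends was unavailable when e was chosen, so its other end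
    was already covered.  For X empty, the critical edges are thus among those
    spanned by 2 M vertices; general X serves the induction and allows to
    complete a given partial matching. *)
Lemma greedy_matching (lam : edge N -> nat) M X : #|X| + 2 * M <= N ->
  exists m, [/\ matching m, #|m| = M, [disjoint covered m & X] &
    forall f, [disjoint val f & X] -> critical lam m f -> val f \subset covered m].
Proof.
elim: M X => [|M IH] X hX.
  exists set0; rewrite cards0 /covered big_set0; split => //.
  - by apply/matchingP => e f; rewrite inE.
  - by rewrite -setI_eq0 set0I.
  - by move=> f _ /existsP[e]; rewrite inE.
have [e0 he0] : exists e, [disjoint val e & X].
  have : 1 < #|~: X| by have := cardsC X; rewrite card_ord; lia.
  case/card_gt1P => u [v []]; rewrite !inE => uX vX uv.
  have [e ee] := edge_of_pair uv; exists e.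
  by rewrite ee disjoints_subset subUset !sub1set !inE uX vX.
case: (@arg_minnP _ e0 (fun e => [disjoint val e & X]) lam he0) => e eX emin.
have [|m [mm cm mX mcrit]] := IH (val e :|: X).
  have := leq_card_setU (val e) X; rewrite /leqif (eqP (valP e)) => -[h _].
  by move: h hX; set a := #|_|; set b := #|_|; lia.
have dme : [disjoint covered [set e] & covered m].
  rewrite covered1 disjoint_sym; apply: disjointWr mX; exact: subsetUl.
have [mme cem] := matching_setU (matching_set1 e) mm dme.
exists (e |: m); split => //.
- by rewrite cem cards1 cm.
- rewrite coveredU covered1 -setI_eq0 setIUl setU_eq0 !setI_eq0 eX /=.
  by apply: disjointWr mX; exact: subsetUr.
move=> f fX /existsP[g /and3P[gem gf lfg]]; rewrite coveredU covered1.
move: gem gf lfg; rewrite in_setU1 => /orP[/eqP-> _|gm gf lfg].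
  by rewrite ltnNge emin.
have [fe|] := boolP ([disjoint val f & val e]).
  apply: subset_trans (subsetUr _ _); apply: mcrit.
    by rewrite disjoint_sym -setI_eq0 setIUl setU_eq0 !setI_eq0 ![[disjoint _ & val f]]disjoint_sym fe fX.
  by apply/existsP; exists g; rewrite gm gf.
move: gf; rewrite -!setI_eq0 => /set0Pn[w /setIP[wg wf]] /set0Pn[u /setIP[uf ue]].
have wm : w \in covered m by apply/coveredP; exists g.
have uw : u != w.
  apply: contraTneq wm => <-; move: dme; rewrite covered1 => /disjointFr -> //.
have -> : val f = [set u; w].
  apply/esym/eqP; rewrite eqEcard subUset !sub1set uf wf /=.
  by rewrite cards2 uw (eqP (valP f)).
by rewrite subUset !sub1set !inE ue wm orbT.
Qed.

Definition critical_set (lam : edge N -> nat) m : {set edge N} := [set f : edge N | critical lam m f].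

Lemma critical_setP (lam : edge N -> nat) m f :
  reflect (exists e v, [/\ e \in m, v \in val e, v \in val f & lam f < lam e])
          (f \in critical_set lam m).
Proof.
rewrite inE; apply: (iffP existsP) => [[e /and3P[em ef lfe]]|[e [v [em ve vf lfe]]]].
  by move: ef; rewrite -setI_eq0 => /set0Pn[v /setIP[ve vf]]; exists e, v.
exists e; rewrite em lfe andbT -setI_eq0; apply/set0Pn.
by exists v; rewrite inE ve.
Qed.

Definition crossing e g : {set edge N} :=
  [set f : edge N | ~~ [disjoint val e & val f] & ~~ [disjoint val g & val f]].

Lemma edge_eq_pair f (u v : 'I_N) : u \in val f -> v \in val f -> u != v -> val f = [set u; v].
Proof.
move=> uf vf uv; apply/esym/eqP.
by rewrite eqEcard subUset !sub1set uf vf cards2 uv (eqP (valP f)).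
Qed.

Lemma edge_meets f (u v : 'I_N) X :
  val f = [set u; v] -> ~~ [disjoint X & val f] = (u \in X) || (v \in X).
Proof.
move=> ->; rewrite -setI_eq0; apply/set0Pn/orP => [[x]|].
  by rewrite !inE => /andP[xX /orP[]/eqP<-]; [left|right].
by case=> h; [exists u|exists v]; rewrite !inE h eqxx ?orbT.
Qed.

Lemma crossingP e g f : [disjoint val e & val g] ->
  reflect (exists u v, [/\ u \in val e, v \in val g, u != v & val f = [set u; v]])
          (f \in crossing e g).
Proof.
move=> dis; rewrite inE; apply: (iffP andP) => [|[u [v [ue vg uv fE]]]].
  rewrite -!setI_eq0 => -[/set0Pn[u /setIP[ue uf]] /set0Pn[v /setIP[vg vf]]].
  have uv : u != v by apply: contraTneq ue => ->; rewrite (disjointFl dis vg).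
  by exists u, v; split => //; exact: edge_eq_pair.
by rewrite !(edge_meets _ fE) ue vg orbT.
Qed.

Lemma card_crossing e g : [disjoint val e & val g] -> #|crossing e g| <= 4.
Proof.
move=> dis.
have -> : 4 = #|setX (val e) (val g)|.
  by rewrite cardsX (eqP (valP e)) (eqP (valP g)).
pose h (p : 'I_N * 'I_N) := [set p.1; p.2].
apply: leq_trans (leq_imset_card h _).
rewrite -(card_imset (crossing e g) val_inj); apply/subset_leq_card/subsetP.
move=> _ /imsetP[f /(crossingP _ dis)[u [v [ue vg uv fE]]] ->].
by apply/imsetP; exists (u, v); rewrite ?inE ?ue ?vg.
Qed.

(** Between two disjoint edges e and g, complementation inside their four ends
    is an involution of the crossing edges without fixed points, and it sends
    each crossing edge to a disjoint one.  A pairwise intersecting family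
    therefore contains at most half of the four crossing edges. *)
Lemma card_crossing_half e g (L : {set edge N}) : [disjoint val e & val g] ->
  L \subset crossing e g ->
  (forall f f', f \in L -> f' \in L -> ~~ [disjoint val f & val f']) -> #|L| <= 2.
Proof.
move=> dis Lsub Lint.
have flip f : f \in crossing e g -> exists2 f', f' \in crossing e g & val f' = (val e :|: val g) :\: val f.
  case/(crossingP _ dis) => u [v [ue vg uv ->]].
  have cu : #|val e :\ u| = 1 by have := cardsD1 u (val e); rewrite ue (eqP (valP e)) add1n => -[].
  have cv : #|val g :\ v| = 1 by have := cardsD1 v (val g); rewrite vg (eqP (valP g)) add1n => -[].
  have /eqP/cards1P[u' eu'] := cu; have /eqP/cards1P[v' ev'] := cv.
  have u'e : u' \in val e by have := set11 u'; rewrite -eu' !inE => /andP[].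
  have v'g : v' \in val g by have := set11 v'; rewrite -ev' !inE => /andP[].
  have u'v' : u' != v' by apply: contraTneq u'e => ->; rewrite (disjointFl dis v'g).
  have [f' f'E] := edge_of_pair u'v'; exists f'; first by apply/crossingP => //; exists u', v'.
  rewrite f'E; apply/setP => x; rewrite !inE negb_or.
  have -> : (x == u') = (x != u) && (x \in val e) by rewrite -in_set1 -eu' !inE.
  have -> : (x == v') = (x != v) && (x \in val g) by rewrite -in_set1 -ev' !inE.
  have [xe|xe] := boolP (x \in val e); have [xg|xg] := boolP (x \in val g) => //=.
  - by rewrite (disjointFl dis xg) in xe.
  - have xv : x != v by apply: contraNneq xg => ->.
    by rewrite (negPf xv) !andbT !andbF !orbF.
  - have xu : x != u by apply: contraNneq xe => ->.
    by rewrite (negPf xu) !andbT !andbF.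
  - by rewrite !andbF.
pose F f := (val e :|: val g) :\: val f.
have sub f : f \in crossing e g -> val f \subset val e :|: val g.
  case/(crossingP _ dis) => u [v [ue vg _ ->]].
  by rewrite subUset !sub1set !inE ue vg orbT.
have injF : {in crossing e g &, injective F}.
  move=> f f' fl fl' /(congr1 (fun A => (val e :|: val g) :\: A)).
  by rewrite !setDDr !setDv !set0U !(setIidPr _) ?sub // => /val_inj.
have : [set val f | f in L] :|: [set F f | f in L] \subset [set val f | f in crossing e g].
  rewrite subUset imsetS //=; apply/subsetP => _ /imsetP[f /(subsetP Lsub) fL ->].
  by have [f' fl' f'E] := flip f fL; apply/imsetP; exists f'.
move/subset_leq_card; rewrite cardsU (card_imset _ val_inj) card_in_imset; last first.
  by move=> f f' /(subsetP Lsub) fl /(subsetP Lsub) fl'; exact: injF.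
rewrite (card_imset _ val_inj).
suff -> : [set val f | f in L] :&: [set F f | f in L] = set0.
  rewrite cards0 subn0 addnn => /leq_trans/(_ (card_crossing dis)).
  by rewrite -(leq_double _ 2).
apply/setP => A; rewrite !inE; apply/negP => /andP[/imsetP[f fL ->] /imsetP[f' fL' ff']].
by have := Lint _ _ fL fL'; rewrite ff' /F -setI_eq0 setDE -setIA (setIC (~: _)) setICr setI0 eqxx.
Qed.

(** Take a matching m0 of label-1 edges, maximal subject to having at most M
    edges, and complete it by a matching m1 outside.  If m0 falls short of M,
    its maximality makes every edge avoiding m0 have label 2, so each critical
    edge joins an edge e of m0 to an edge g of m1.  Two disjoint such edges
    between e and g could replace e in m0, so each pair (e, g) accounts for at
    most two critical edges: the total is at most 2 #|m0| (M - #|m0|). *)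
Lemma two_label_matching (lam : edge N -> nat) M : 2 * M <= N ->
  (forall e, 1 <= lam e <= 2) ->
  exists m, [/\ matching m, #|m| = M & 2 * #|critical_set lam m| <= M ^ 2].
Proof.
move=> MN lam12.
pose ok m := [&& matching m, #|m| <= M & [forall e in m, lam e == 1]].
have ok0 : ok set0.
  rewrite /ok cards0 /=; apply/andP; split; first by apply/matchingP => e f; rewrite inE.
  by apply/forallP => e; rewrite inE.
case: (@arg_maxnP _ set0 ok (fun m => #|m|) ok0) => m0 /and3P[mm0 m0M /forall_inP m0l] m0max.
have lam2 e : lam e != 1 -> lam e = 2.
  by move: (lam12 e); move: (lam e) => a; clear; lia.
have lam1 f e : lam f < lam e -> lam f = 1.
  by move: (lam12 e) (lam12 f); move: (lam e) (lam f) => a b; clear; lia.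
have [|m1 [mm1 cm1 dis _]] := @greedy_matching lam (M - #|m0|) (covered m0).
  by rewrite card_covered // -mulnDr subnKC.
rewrite disjoint_sym in dis.
have [mm cm] := matching_setU mm0 mm1 dis; exists (m0 :|: m1); split => //.
  by rewrite cm cm1 subnKC.
have [m0M'|m0M'] := eqVneq #|m0| M.
  suff -> : critical_set lam (m0 :|: m1) = set0 by rewrite cards0.
  have m10 : m1 = set0 by apply/eqP; rewrite -cards_eq0 cm1 m0M' subnn.
  apply/setP => f; rewrite [RHS]inE; apply/negP => /critical_setP[e [v [em _ _]]].
  move: em; rewrite m10 setU0 => /m0l/eqP le lf.
  by move: (lf); rewrite (lam1 _ _ lf) le.
have m0lt : #|m0| < M by rewrite ltn_neqAle m0M' m0M.
(* Otherwise e could be added to m0. *)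
have noaug e : [disjoint val e & covered m0] -> lam e = 2.
  move=> eX; apply: lam2; apply/negP => le.
  have [] := matching_setU mm0 (matching_set1 e); first by rewrite covered1 disjoint_sym.
  rewrite cards1 => me ce; have := m0max (m0 :|: [set e]).
  rewrite /ok me ce; have -> : [forall e' in m0 :|: [set e], lam e' == 1].
    by apply/forall_inP => e' /setUP[/m0l//|/set1P->].
  by rewrite andbT addn1 => /(_ m0lt) /=; rewrite ltnn.
have m0m1 e g : e \in m0 -> g \in m1 -> [disjoint val e & val g].
  by move=> em gm; apply: disjointW dis; exact: bigcup_sup.
pose L e g := [set f in crossing e g | lam f == 1].
have critL : critical_set lam (m0 :|: m1) \subset \bigcup_(p in setX m0 m1) L p.1 p.2.
  apply/subsetP => f /critical_setP[g [v [gm vg vf lfg]]].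
  have lf := lam1 _ _ lfg.
  have gm1 : g \in m1.
    by case/setUP: gm => // /m0l/eqP lg; rewrite lg lf in lfg.
  have : ~~ [disjoint val f & covered m0] by apply/negP => /noaug; rewrite lf.
  rewrite -setI_eq0 => /set0Pn[u /setIP[uf /coveredP[e em ue]]].
  apply/bigcupP; exists (e, g); rewrite !inE ?em ?gm1 //= lf eqxx andbT.
  by rewrite -!setI_eq0; apply/andP; split; apply/set0Pn; [exists u|exists v]; apply/setIP.
have cardL e g : e \in m0 -> g \in m1 -> #|L e g| <= 2.
  move=> em gm; have deg := m0m1 e g em gm.
  apply: (card_crossing_half deg); first by apply/subsetP => f; rewrite inE => /andP[].
  move=> f f'; rewrite inE => /andP[fl lf]; rewrite inE => /andP[fl' lf'].
  apply/negP => ff'.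
  have subL f0 : f0 \in crossing e g -> val f0 \subset val e :|: val g.
    case/(crossingP _ deg) => u [v [ue vg _ ->]].
    by rewrite subUset !sub1set !inE ue vg orbT.
  have mf : matching (m0 :\ e).
    by apply/matchingP => a b /setD1P[_ ?] /setD1P[_ ?]; exact: (matchingP _ mm0).
  have dff : [disjoint covered [set f] & covered [set f']] by rewrite !covered1.
  have [m2 c2] := matching_setU (matching_set1 f) (matching_set1 f') dff.
  have [] := matching_setU mf m2.
    apply: disjointWr (_ : [disjoint covered (m0 :\ e) & val e :|: val g]).
      by rewrite coveredU !covered1 subUset !subL.
    rewrite -setI_eq0 setIUr setU_eq0 !setI_eq0; apply/andP; split.
      rewrite -setI_eq0; apply/eqP/setP => x; rewrite !inE; apply/negP => /andP[/coveredP[a]].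
      rewrite !inE => /andP[ae am] xa; apply/negP.
      by rewrite (disjointFr (matchingP _ mm0 a e am em ae) xa).
    apply: disjointW dis; last exact: bigcup_sup.
    by apply/subsetP => x /coveredP[a /setD1P[_ am] xa]; apply/coveredP; exists a.
  set m' := _ :|: _ => mm' cm'; have := m0max m'; rewrite /ok mm' /=.
  have -> : [forall e in m', lam e == 1].
    by apply/forall_inP => a; rewrite !inE => /orP[/andP[_ /m0l//]|/orP[]/eqP->].
  have E : #|m0| = #|m0 :\ e|.+1 by rewrite (cardsD1 e m0) em.
  by rewrite cm' c2 !cards1 andbT addn2 -E => /(_ m0lt) /=; rewrite ltnn.
have : #|critical_set lam (m0 :|: m1)| <= #|m0| * #|m1| * 2.
  apply: leq_trans (subset_leq_card critL) _.
  apply: leq_trans (_ : \sum_(p in setX m0 m1) #|L p.1 p.2| <= _).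
    apply: (big_ind2 (fun (A : {set edge N}) k => #|A| <= k)) => //.
      by rewrite cards0.
    move=> A a B b Aa Bb; apply: leq_trans (leq_add Aa Bb).
    by have [] := leq_card_setU A B.
  rewrite -cardsX -sum_nat_const; apply: leq_sum => -[e g].
  by rewrite inE /= => /andP[]; exact: cardL.
rewrite cm1; move: m0M; move: #|critical_set _ _| #|m0| => k a; clear.
move=> /subnKC <-; rewrite addKn; set b := M - a => h; have := nat_AGM2 a b.
by apply: leq_trans; lia.
Qed.

(** Let the label of an edge be the least colour c of its ends.  A matching edge
    of label at most j contains a vertex of colour at most j, so a perfect
    matching has few of them, and the vertices v covered by matching edges of
    label above j are many.  Each of them spans a critical edge of label j with
    every vertex of colour j. *)
Lemma critical_level (c : 'I_N -> nat) (lam : edge N -> nat) m j :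
  (forall e v, v \in val e -> lam e <= c v) ->
  (forall e, exists2 v, v \in val e & lam e = c v) ->
  matching m -> 2 * #|m| = N ->
  #|[set v | c v == j]| * (N - 2 * #|[set v | c v <= j]|) <=
    #|[set f in critical_set lam m | lam f == j]|.
Proof.
move=> lamle lamE mm mN.
pose m' := [set e in m | lam e <= j]; pose m'' := m :\: m'.
(* Each matching edge of small label is charged to one of its ends that attains
   the label; the edges are disjoint, so the charging is injective. *)
have cm' : #|m'| <= #|[set v | c v <= j]|.
  have rep e : exists v, (v \in val e) && (lam e == c v).
    by have [v ve le] := lamE e; exists v; rewrite ve le eqxx.
  pose r e := xchoose (rep e).
  have re e : r e \in val e by have /andP[] := xchooseP (rep e).
  have rc e : lam e = c (r e) by have /andP[_ /eqP] := xchooseP (rep e).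
  rewrite -(@card_in_imset _ _ r m'); last first.
    move=> e f; rewrite !inE => /andP[em _] /andP[fm _] ef; apply/eqP/negPn/negP => nef.
    by have := disjointFr (matchingP _ mm e f em fm nef) (re e); rewrite ef re.
  apply/subset_leq_card/subsetP => _ /imsetP[e + ->].
  by rewrite !inE -rc => /andP[].
have mm'' : matching m''.
  by apply/matchingP => a b /setDP[? _] /setDP[? _]; exact: (matchingP _ mm).
have cm'' : #|m''| = #|m| - #|m'|.
  rewrite cardsD; congr (_ - _); apply: eq_card => e; rewrite !inE andbA.
  by case: (e \in m).
set A := [set v | c v == j].
apply: leq_trans (_ : #|setX A (covered m'')| <= _).
  by rewrite cardsX card_covered // leq_mul2l cm''; apply/orP; right; lia.
(* The vertices covered by m'' have colour above j, so they are disjoint from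
   the hub A and no edge is counted twice. *)
have cB v : v \in covered m'' -> j < c v.
  case/coveredP => e; rewrite !inE => /andP[+ em] ve; rewrite em /= -ltnNge => le.
  exact: leq_trans le (lamle _ _ ve).
pose h (p : 'I_N * 'I_N) := [set p.1; p.2].
rewrite -(@card_in_imset _ _ h); last first.
  move=> [a b] [a' b']; rewrite !in_setX !inE => /andP[/eqP /= ca /cB cb] /andP[/eqP /= ca' /cB cb'] E.
  have /set2P Ha : a \in [set a'; b'] by rewrite -[[set a'; b']]E set21.
  have /set2P Hb : b \in [set a'; b'] by rewrite -[[set a'; b']]E set22.
  have aa' : a = a' by case: Ha => // ab'; rewrite -ab' ca ltnn in cb'.
  by case: Hb => bb'; [rewrite bb' ca' ltnn in cb|rewrite aa' bb'].
rewrite -(card_imset [set f in critical_set lam m | lam f == j] val_inj).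
apply/subset_leq_card/subsetP => _ /imsetP[[a b] + ->].
rewrite in_setX inE /= => /andP[/eqP ca bm].
have ab : a != b by apply: contraTneq (cB b bm) => <-; rewrite ca ltnn.
have [f fE] := edge_of_pair ab; apply/imsetP; exists f => //.
have lf : lam f = j.
  have := lamle f a; rewrite fE !inE eqxx ca => /(_ isT) h1.
  have [v] := lamE f; rewrite fE !inE => /orP[]/eqP-> h2; first by rewrite h2.
  by have := cB b bm; lia.
rewrite inE lf eqxx andbT; apply/critical_setP.
case/coveredP: bm => e; rewrite !inE => /andP[+ em] be; rewrite em /= -ltnNge => le.
by exists e, b; rewrite fE !inE eqxx orbT lf.
Qed.

End Matchings.

Lemma card_ord_ltn N k : k <= N -> #|[set v : 'I_N | v < k]%SET| = k.
Proof.
move=> kN; rewrite -sum1_card -[RHS]card_ord -sum1_card.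
by rewrite (big_ord_widen N (fun=> 1) kN); apply: eq_bigl => v; rewrite inE.
Qed.

Lemma sum_card_levels_le (T : finType) (C : {set T}) (lam : T -> nat) K :
  \sum_(j < K) #|[set f in C | lam f == j.+1]%SET| <= #|C|.
Proof.
under eq_bigr => j _ do rewrite -sum1_card big_mkcond /=.
rewrite exchange_big /= -sum1_card [leqRHS]big_mkcond /=; apply: leq_sum => f _.
under eq_bigr => j _ do rewrite inE.
case: (f \in C) => /=; last by rewrite big1.
case: (lam f) => [|k]; first by rewrite big1.
have [kK|kK] := ltnP k K.
  rewrite (bigD1 (Ordinal kK)) //= eqxx big1 // => j; rewrite -val_eqE /= eqSS.
  by rewrite eq_sym => /negPf ->.
by rewrite big1 // => j _; rewrite eqSS; case: eqP => // kj; move: (ltn_ord j); rewrite -kj ltnNge kK.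
Qed.

(** Stated for twice the sum, to stay in the natural numbers. *)
Lemma sum_rev_ord2 K : (\sum_(j < K) (K - j)) * 2 = K * K.+1.
Proof.
elim: K => [|K IH]; first by rewrite big_ord0.
rewrite big_ord_recl subn0 mulnDl.
under eq_bigr => j _ do rewrite subSS.
by rewrite IH; clear; lia.
Qed.

(** The vertices of a complete graph on 2 (K+1) m vertices are split into hubs of
    m vertices with colours 1, ..., K and a remainder of colour K+1.  For the
    label given by the least colour, level j contributes at least
    m (2 (K+1) m - 2 j m) critical edges for every perfect matching. *)
Lemma layered_labeling K m N : 0 < m -> N = 2 * (K.+1 * m) ->
  exists lam : edge N -> nat, (forall e, 1 <= lam e <= K.+1) /\
    forall mt, matching mt -> #|mt| = K.+1 * m -> K * K.+1 * m ^ 2 <= #|critical_set lam mt|.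
Proof.
move=> m0 NE; pose c (v : 'I_N) := minn K.+1 (v %/ m).+1.
have /choice[lam lamP] : forall e : edge N, exists k,
    (forall v, v \in val e -> k <= c v) /\ exists2 v, v \in val e & k = c v.
  move=> e; have ex : exists k, [exists v in val e, c v == k].
    have [u [v [_ ->]]] := edge_ends e; exists (c u); apply/existsP; exists u.
    by rewrite !inE !eqxx.
  case: (ex_minnP ex) => k /exists_inP[v ve /eqP cv] kmin; exists k; split.
    by move=> w we; apply: kmin; apply/exists_inP; exists w.
  by exists v.
have clt j : j < K -> [set v | c v <= j.+1]%SET = [set v : 'I_N | v < j.+1 * m]%SET.
  move=> jK; apply/setP => v; rewrite !inE /c geq_min !ltnS leqNgt jK /=.
  by rewrite -ltnS ltn_divLR.
have jN j : j < K -> j.+1 * m <= N.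
  by move=> jK; rewrite NE mulnA leq_mul2r; apply/orP; right; move: jK; clear; lia.
have cardlt j : j < K -> #|[set v | c v <= j.+1]%SET| = j.+1 * m.
  by move=> jK; rewrite clt // card_ord_ltn // jN.
have cardeq j : j < K -> #|[set v | c v == j.+1]%SET| = m.
  move=> jK.
  have -> : [set v | c v == j.+1]%SET =
      [set v : 'I_N | v < j.+1 * m]%SET :\: [set v : 'I_N | v < j * m]%SET.
    apply/setP => v; rewrite !inE -leqNgt -leq_divRL // -ltn_divLR // /c ltnS.
    by move: (v %/ m) jK => q; clear; lia.
  have jN' : j * m <= N by apply: leq_trans (jN j jK); rewrite leq_mul2r leqnSn orbT.
  rewrite cardsDS; first by rewrite !card_ord_ltn ?jN // mulSn addnK.
  apply/subsetP => v; rewrite !inE => /leq_trans; apply.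
  by rewrite leq_mul2r leqnSn orbT.
exists lam; split.
  move=> e; have [v _ ->] := (lamP e).2; rewrite /c.
  by move: (v %/ m) => q; clear; lia.
move=> mt mmt cmt; apply: leq_trans (sum_card_levels_le _ lam K).
apply: leq_trans (_ : \sum_(j < K) m * (N - 2 * (j.+1 * m)) <= _); last first.
  apply: leq_sum => j _; rewrite -{1}(cardeq j) // -(cardlt j) //.
  apply: critical_level => //.
  - by move=> e v; exact: (lamP e).1.
  - by move=> e; exact: (lamP e).2.
  - by rewrite cmt NE.
rewrite (eq_bigr (fun j : 'I_K => (K - j) * 2 * m ^ 2)); last first.
  move=> j _; rewrite NE -mulnBr -mulnBl subSS; set k := K - j; clear; nia.
by rewrite -big_distrl -big_distrl /= sum_rev_ord2.
Qed.

(** * Bounds on gamma *)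

Section Gamma.
Local Open Scope ring_scope.
Local Open Scope ereal_scope.
Variable R : realType.
Implicit Types (l : enat) (M : nat).

Lemma bin2_double M : 'C(2 * M, 2) = (M * (2 * M).-1)%N.
Proof. by rewrite bin2 -mulnA mul2n doubleK. Qed.

Lemma limn_esup_ge (u : (\bar R)^nat) x :
  (forall n, exists2 k, (n <= k)%N & x <= u k) -> x <= limn_esup u.
Proof.
move=> h; rewrite limn_esup_lim (cvg_lim _ (@cvg_esups_inf _ u)) //.
apply: le_ereal_inf_tmp => _ [n _ <-]; have [k nk xk] := h n.
by apply: le_trans xk _; apply: ereal_sup_ubound; exists k.
Qed.

Lemma limn_esup_le (u : (\bar R)^nat) x n0 :
  (forall n, (n0 <= n)%N -> u n <= x) -> limn_esup u <= x.
Proof.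
move=> h; rewrite limn_esup_lim (cvg_lim _ (@cvg_esups_inf _ u)) //.
apply: ge_ereal_inf; exists (esups u n0); first by exists n0.
by apply: ge_ereal_sup => _ [n /= nn0 <-]; exact: h.
Qed.

Lemma limn_esup_lt (u : (\bar R)^nat) x :
  limn_esup u < x -> exists n0, forall n, (n0 <= n)%N -> u n < x.
Proof.
rewrite limn_esup_lim (cvg_lim _ (@cvg_esups_inf _ u)) //.
move=> /ereal_inf_lt[_ [n0 _ <-] h]; exists n0 => n nn0.
by apply: le_lt_trans h; apply: ereal_sup_ubound; exists n.
Qed.

Lemma critical_ratioE M N (lam : edge N -> nat) m :
  critical_ratio R M lam m = (#|critical_set lam m|%:R / 'C(2 * M, 2)%:R)%R.
Proof. by []. Qed.

Lemma max_min_ratio_le l M (x : R) :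
  (forall N (lam : edge N -> nat), (2 * M <= N)%N -> labeling l lam ->
    exists m, [/\ matching m, #|m| = M & (critical_ratio R M lam m <= x)%R]) ->
  max_min_ratio R l M <= x%:E.
Proof.
move=> h; apply: ge_ereal_sup => _ [N [lam [MN ll ->]]].
have [m [mm cm mx]] := h N lam MN ll.
apply: ge_ereal_inf; exists (critical_ratio R M lam m)%:E; last by rewrite lee_fin.
by exists m.
Qed.

(** The greedy matching keeps all critical edges inside the 2 M covered
    vertices. *)
Lemma max_min_ratio_le1 l M : max_min_ratio R l M <= 1%:E.
Proof.
apply: max_min_ratio_le => N lam MN _.
have [|m [mm cm _ mcrit]] := @greedy_matching _ lam M finset.set0; first by rewrite cards0.
exists m; split => //; rewrite critical_ratioE.
have le : (#|critical_set lam m| <= 'C(2 * M, 2))%N.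
  rewrite -cm -card_covered // -cards_draws.
  rewrite -(card_imset (critical_set lam m) val_inj); apply/subset_leq_card/subsetP.
  move=> _ /imsetP[f fc ->]; rewrite !inE (valP f) mcrit //.
    by rewrite -setI_eq0 setI0.
  by move: fc; rewrite inE.
have [->|/eqP C0] := eqVneq 'C(2 * M, 2) 0%N; first by rewrite invr0 mulr0.
by rewrite ler_pdivrMr ?mul1r ?ler_nat // ltr0n lt0n; apply/eqP.
Qed.

Lemma limn_esup_layered l K : le_enat K.+1 l ->
  (K%:R / (2 * K.+1%:R))%:E <= limn_esup (max_min_ratio R l).
Proof.
move=> Kl; apply: limn_esup_ge => n; exists (K.+1 * n.+1)%N.
  by rewrite mulSn; apply: leq_trans (leq_addr _ _).
set M := (K.+1 * n.+1)%N.
have [lam [lam1 lamc]] := @layered_labeling K n.+1 (2 * M) isT erefl.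
apply: (@le_trans _ _ (min_ratio R M lam)); last first.
  apply: ereal_sup_ubound; exists (2 * M)%N, lam; split => // e.
  have /andP[-> /= h] := lam1 e; split => //.
  by case: l Kl => //= l Kl; exact: leq_trans h Kl.
apply: le_ereal_inf_tmp => _ [m [mm cm] <-]; rewrite lee_fin critical_ratioE.
have h := lamc m mm cm.
rewrite bin2_double ler_pdivrMr ?mulr_gt0 ?ltr0n //.
rewrite mulrAC ler_pdivlMr ?ltr0n; last by rewrite /M; lia.
rewrite -!natrM ler_nat; apply: leq_trans (_ : K * K.+1 * n.+1 ^ 2 * (2 * K.+1) <= _)%N.
  apply: (@leq_trans (K * (M * (2 * M)))%N); first by rewrite !leq_mul ?leq_pred.
  by rewrite /M; move: (n.+1) (K.+1) => a b; apply: eq_leq; ring.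
by rewrite leq_mul2r h orbT.
Qed.

(** Without finiteness the real number gamma would say nothing about the limit
    superior behind it. *)
Lemma limn_esup_max_min_fin l : le_enat 1 l ->
  limn_esup (max_min_ratio R l) \is a fin_num.
Proof.
move=> l1; have := @limn_esup_layered l 0 l1; rewrite mul0r => h.
rewrite fin_numE -ltNye -ltey; apply/andP; split.
  by apply: lt_le_trans h; rewrite ltNyr.
apply: (@le_lt_trans _ _ 1%:E); last by rewrite ltry.
by apply: (@limn_esup_le _ _ 0%N) => n _; exact: max_min_ratio_le1.
Qed.

Lemma gammaE l : le_enat 1 l -> (gamma R l)%:E = limn_esup (max_min_ratio R l).
Proof. by move=> /limn_esup_max_min_fin h; rewrite /gamma fineK. Qed.

(** The nested hubs with K+1 colours give the ratio
    K (K+1) m^2 / ((K+1) m (2 (K+1) m - 1)), which is at least K / (2 (K+1)). *)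
Lemma gamma_ge l K : le_enat K.+1 l -> (K%:R / (2 * K.+1%:R) <= gamma R l)%R.
Proof.
move=> h; rewrite -lee_fin gammaE ?limn_esup_layered //.
by case: l h => //= l; apply: leq_trans.
Qed.

(** At most M^2 / 2 critical edges ([two_label_matching]) among M (2 M - 1) pairs:
    the ratio exceeds 1/4 by less than e once e M >= 1. *)
Lemma gamma2_le : (gamma R (Some 2%N) <= 1 / 4)%R.
Proof.
rewrite -lee_fin gammaE //; apply/lee_addgt0Pr => e e0.
pose n0 := (Num.truncn e^-1).+1.
apply: (@limn_esup_le _ _ n0) => M M0; apply: max_min_ratio_le => N lam MN ll.
have [|m [mm cm mc]] := @two_label_matching N lam M MN.
  by move=> f; have [-> ] := ll f.
exists m; split => //.
rewrite critical_ratioE bin2_double.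
have Me : (e^-1 <= M%:R)%R.
  by apply: le_trans (ltW (truncnS_gt _)) _; rewrite ler_nat.
have M1 : (1 <= M%:R :> R)%R by rewrite ler1n; apply: leq_ltn_trans M0.
have M1' : (0 < 2 * M)%N by rewrite muln_gt0 /=; apply: leq_ltn_trans M0.
have eM : (1 <= e * M%:R)%R by rewrite -ler_pdivrMl ?mulr1.
have c2 : (2 * #|critical_set lam m|%:R <= M%:R ^+ 2 :> R)%R by rewrite -natrX -natrM ler_nat.
have pM : ((M * (2 * M).-1)%:R = M%:R * (2 * M%:R - 1) :> R)%R.
  by rewrite natrM -subn1 natrB // natrM.
rewrite pM ler_pdivrMr; last by nra.
nra.
Qed.

(** The strict inequality absorbs the limit superior and the infimum over the
    matchings, so that one threshold M0 serves all N and all labelings. *)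
Lemma gamma_matching l (g : R) : le_enat 1 l -> (gamma R l < g)%R ->
  exists M0, forall M N (lam : edge N -> nat), (M0 <= M)%N -> (2 * M <= N)%N ->
    labeling l lam -> exists m, [/\ matching m, #|m| = M &
      (#|critical_set lam m|%:R <= g * 'C(2 * M, 2)%:R)%R].
Proof.
move=> l1; rewrite -lte_fin gammaE // => /limn_esup_lt[M0 hM0].
exists M0.+1 => M N lam M0M MN ll.
have : min_ratio R M lam < g%:E.
  apply: le_lt_trans (hM0 M (ltnW M0M)); apply: ereal_sup_ubound.
  by exists N, lam.
case/ereal_inf_lt => _ [m [mm cm] <-]; rewrite lte_fin critical_ratioE => h.
exists m; split => //; rewrite -ler_pdivrMr; first exact: ltW.
rewrite ltr0n bin_gt0; move: M0M; clear; lia.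
Qed.

End Gamma.

(** * Revealing the graph through queries *)

Section Process.
Local Open Scope set_scope.

(** A revelation step.  For a uniform random subset G of T, let D G be a set of
    elements that is determined by G outside D G; then each element of D G
    belongs to G independently with probability one half.  The union of G and
    D G identifies the group of sets that differ from G only on D G, and the
    member of the group containing D G collects the weight of all its 2^#|D G|
    members. *)
Lemma sum_revealed (T : finType) (w : {set T} -> nat) (D : {set T} -> {set T}) :
  (forall G G', G :\: D G = G' :\: D G -> w G' = w G /\ D G' = D G) ->
  \sum_(G | D G \subset G) w G * 2 ^ #|D G| <= \sum_G w G.
Proof.
move=> inv; rewrite [leqRHS](partition_big (fun G => G :|: D G) predT) //=.
rewrite big_mkcond /=; apply: leq_sum => G _; case: ifP => // DG.
rewrite -card_powerset mulnC -sum_nat_const.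
(* The sets in the group of G are obtained by removing from G a part of D G. *)
have wE B : B \in powerset (D G) -> w (G :\: B) = w G /\ D (G :\: B) = D G.
  rewrite powersetE => BD; apply: inv.
  by rewrite setDDl (setUidPr BD).
have injD : {in powerset (D G) &, injective (fun B => G :\: B)}.
  move=> B B'; rewrite !powersetE => BD BD' /(congr1 (fun X => G :\: X)).
  by rewrite !setDDr !setDv !set0U !(setIidPr _) // (subset_trans _ DG).
rewrite [leqLHS](eq_bigr (fun B => w (G :\: B))); last by move=> B BD; have [-> _] := wE B BD.
rewrite -(big_imset w injD) /= [leqLHS]big_mkcond [leqRHS]big_mkcond /=.
apply: leq_sum => G' _; case: ifP => // /imsetP[B BD ->].
have [_ ->] := wE B BD; rewrite setUC.
suff -> : D G :|: G :\: B = G by rewrite eqxx.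
apply/eqP; rewrite eqEsubset subUset DG subsetDl /=.
apply/subsetP => x xG; rewrite !inE xG andbT.
rewrite powersetE in BD.
by have [/(subsetP BD)->|] := boolP (x \in B); rewrite ?orbT.
Qed.

Variables (n : nat) (A : algorithm n).
Implicit Types (G : {set edge n}).

Fixpoint asked G t : seq (edge n) :=
  if t is t'.+1 then asked G t' ++ enum (query A (answers A G t')) else [::].

Lemma size_asked G : size (asked G (rounds A)) = num_queries A G.
Proof.
rewrite /num_queries; elim: (rounds A) => [|r IH] /=; first by rewrite big_ord0.
by rewrite big_ord_recr /= size_cat IH -cardE.
Qed.

Lemma mem_asked G e t :
  reflect (exists2 i, i < t & e \in query A (answers A G i)) (e \in asked G t).
Proof.
elim: t => [|t IH] /=; first by constructor => -[].
rewrite mem_cat mem_enum; apply: (iffP orP) => [[/IH[i it ei]|et]|[i]].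
- by exists i => //; exact: ltnW.
- by exists t.
- rewrite ltnS leq_eqVlt => /orP[/eqP->|it ei]; [by right|left].
  by apply/IH; exists i.
Qed.

Lemma asked_prefix G t r : t <= r -> exists s, asked G r = asked G t ++ s.
Proof.
move=> /subnKC <-; elim: (r - t) => [|k [s E]]; first by exists [::]; rewrite addn0 cats0.
by rewrite addnS /= E; eexists; rewrite -catA.
Qed.

Lemma asked_sub G t r : t <= r -> {subset asked G t <= asked G r}.
Proof. by move=> tr e; have [s ->] := asked_prefix G tr; rewrite mem_cat => ->. Qed.

Lemma answers_agree G G' t : {in asked G t, forall e, (e \in G') = (e \in G)} ->
  answers A G' t = answers A G t.
Proof.
elim: t => //= t IH h; rewrite IH; last by move=> e et; rewrite h // mem_cat et.
congr rcons; apply/setP => e; rewrite !inE.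
by case: (boolP (e \in query _ _)) => //= eq; rewrite h // mem_cat mem_enum eq orbT.
Qed.

Lemma asked_agree G G' t i : {in asked G t, forall e, (e \in G') = (e \in G)} ->
  i <= t.+1 -> asked G' i = asked G i.
Proof.
move=> h; elim: i => //= i IH it; rewrite IH ?(ltnW it) // (@answers_agree G) //.
by move=> e ei; apply: h; exact: (@asked_sub G _ _ (it : i <= t) _ ei).
Qed.

Definition fully_queried G :=
  [forall e : edge n, (val e \subset result A G) ==> (e \in asked G (rounds A))].

(** Toggling an unqueried pair of the output leaves the run of the algorithm
    unchanged and destroys the clique. *)
Lemma unqueried_half :
  2 * #|[set G : {set edge n} | is_clique G (result A G) && ~~ fully_queried G]| <=
    #|[set G : {set edge n} | ~~ fully_queried G]|.
Proof.
pose D G : {set edge n} :=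
  if [pick e : edge n | (val e \subset result A G) && (e \notin asked G (rounds A))] is Some e
  then [set e] else set0.
have DP G : ~~ fully_queried G -> exists2 e, D G = [set e] & val e \subset result A G.
  rewrite negb_forall => /existsP[e]; rewrite negb_imply => he; rewrite /D.
  by case: pickP => [e' /andP[h _]|/(_ e)]; [exists e'|rewrite he].
have inv G G' : G :\: D G = G' :\: D G ->
    ~~ fully_queried G' = ~~ fully_queried G :> nat /\ D G' = D G.
  move=> GG'.
  have h : {in asked G (rounds A), forall e, (e \in G') = (e \in G)}.
    move=> e ea; have := congr1 (fun X : {set edge n} => e \in X) GG'.
    rewrite /= !inE; suff -> : e \notin D G by [].
    rewrite /D; case: pickP => [e' /andP[_ e'a]|_]; last by rewrite inE.
    by rewrite inE; apply: contraNneq e'a => <-.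
  have rE : result A G' = result A G by rewrite /result (answers_agree h).
  have aE := asked_agree h (leqnSn _).
  by rewrite /fully_queried /D rE aE.
have <- : \sum_G (~~ fully_queried G : nat) = #|[set G : {set edge n} | ~~ fully_queried G]|.
  by rewrite -sum1_card [RHS]big_mkcond /=; apply: eq_bigr => G _; rewrite inE; case: (~~ _).
apply: leq_trans (sum_revealed inv).
rewrite -sum1_card big_distrr /= big_mkcond [leqRHS]big_mkcond /=.
apply: leq_sum => G _; rewrite inE; case: ifP => // /andP[Gc Gf].
have [e DE er] := DP G Gf; rewrite DE cards1 Gf sub1set.
by move/forallP: Gc => /(_ e); rewrite er /= => ->.
Qed.

Section Code.
Variables (I : pred nat) (W : {set 'I_n}).

(** The vertices located by the code (I, W) before round t: those listed in W
    and the ends of the queried pairs whose positions belong to I. *)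
Definition known G t : {set 'I_n} :=
  W :|: covered [set e : edge n | (e \in asked G t) && I (index e (asked G t))].

(** The pairs first queried in round t (counted from 0) whose two ends are located
    by then.  The positions of the queries of round t are known before their
    answers, hence the index t.+1; this is why an edge with the same label as a
    matching edge does not count as critical. *)
Definition fresh G t : {set edge n} :=
  [set e in query A (answers A G t) | (e \notin asked G t) && (val e \subset known G t.+1)].

Fixpoint settled G t : {set edge n} :=
  if t is t'.+1 then settled G t' :|: fresh G t' else set0.

Lemma mem_settled G e t :
  reflect (exists2 i, i < t & e \in fresh G i) (e \in settled G t).
Proof.
elim: t => [|t IH] /=; first by rewrite inE; constructor => -[].
rewrite inE; apply: (iffP orP) => [[/IH[i it ei]|et]|[i]].
- by exists i => //; exact: ltnW.
- by exists t.
- rewrite ltnS leq_eqVlt => /orP[/eqP->|it ei]; [by right|left].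
  by apply/IH; exists i.
Qed.

Lemma settled_asked G e t : e \in settled G t -> e \in asked G t.
Proof.
case/mem_settled => i it; rewrite inE => /andP[eq _].
by apply/mem_asked; exists i.
Qed.

(** What happens up to the choice of the queries of round t depends only on the
    answers of the previous rounds. *)
Lemma settled_agree G G' t : {in asked G t, forall e, (e \in G') = (e \in G)} ->
  settled G' t = settled G t /\ fresh G' t = fresh G t.
Proof.
move=> h; have kE i : i <= t.+1 -> known G' i = known G i.
  by move=> it; rewrite /known (asked_agree h it).
have fE i : i <= t -> fresh G' i = fresh G i.
  move=> it; rewrite /fresh kE // (asked_agree h) ?(leqW it) // (@answers_agree G) //.
  by move=> e ei; apply: h; exact: (@asked_sub G _ _ it _ ei).
split; last exact: fE.
have : t <= t by []; elim: {-2}t => //= i IH it.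
by rewrite fE ?IH // ltnW.
Qed.

(** The quantity 2^#|settled G t|, set to 0 once a settled pair is not an edge,
    has constant mean: the fresh pairs of round t are determined by the earlier
    answers, so [sum_revealed] applies to them. *)
Lemma settled_weight t :
  \sum_(G | settled G t \subset G) 2 ^ #|settled G t| <= 2 ^ #|{: edge n}|.
Proof.
elim: t => [|t IH] /=.
  rewrite cards0 (eq_bigl predT) => [|G]; last by rewrite sub0set.
  by rewrite sum1_card -cardsT -powersetT card_powerset cardsT.
apply: leq_trans IH; rewrite [leqRHS]big_mkcond /=.
pose w G := if settled G t \subset G then 2 ^ #|settled G t| else 0.
apply: leq_trans (@sum_revealed _ w (fun G => fresh G t) _); last first.
  move=> G G' GG'.
  have h : {in asked G t, forall e, (e \in G') = (e \in G)}.
    move=> e ea; have := congr1 (fun X : {set edge n} => e \in X) GG'.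
    by rewrite /= !inE ea andbF.
  have [sE fE] := settled_agree h; rewrite fE /w sE; split => //.
  suff -> : (settled G t \subset G') = (settled G t \subset G) by [].
  by apply/subsetP/subsetP => H e es; [rewrite -h|rewrite h] => //;
    try apply: H => //; exact: settled_asked.
rewrite big_mkcond [leqRHS]big_mkcond /=; apply: leq_sum => G _.
rewrite subUset /w; case: (settled G t \subset G) => //=.
case: (fresh G t \subset G) => //; rewrite -expnD leq_exp2l //.
by have [] := leq_card_setU (settled G t) (fresh G t).
Qed.

End Code.

Definition good_graphs (N : nat) := [set G : {set edge n} |
  [&& is_clique G (result A G), fully_queried G & #|result A G| == N]].

(** Positions in a list of queries are natural numbers, while codes are counted as
    subsets of a finite type; this is the passage from the latter to the former. *)
Definition positions q (J : {set 'I_q}) : pred nat := fun k => [exists i in J, val i == k].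

Lemma index_asked G e t r : t <= r -> e \in asked G t ->
  index e (asked G r) = index e (asked G t).
Proof. by move=> tr et; have [s ->] := asked_prefix G tr; rewrite index_cat et. Qed.

Lemma index_inj_in (T : eqType) (s : seq T) x y :
  x \in s -> y \in s -> index x s = index y s -> x = y.
Proof. by move=> xs ys xy; rewrite -(nth_index x xs) xy nth_index. Qed.

(** The code of a good graph consists of the positions J of the matching pairs in
    the list of queries and of the unmatched vertices W of the clique.  A
    noncritical pair is queried no earlier than the matching pairs at its ends,
    so it is fresh in its own round. *)
Lemma good_graph_code (q N M T : nat) G :
  num_queries A G <= q -> G \in good_graphs N ->
  (forall lam : edge N -> nat, (forall e : edge N, 1 <= lam e <= rounds A) ->
    exists m, [/\ matching m, #|m| = M & #|critical_set lam m| + T <= 'C(N, 2)]) ->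
  exists (J : {set 'I_q}) (W : {set 'I_n}),
    [/\ #|J| = M, #|W| = N - 2 * M,
        settled (positions J) W G (rounds A) \subset G &
        T <= #|settled (positions J) W G (rounds A)|].
Proof.
rewrite inE; set r := rounds A; set S := result A G => Gq /and3P[cliqueS fullS /eqP cardS] hlam.
have [f [finj fS]] : exists f : 'I_N -> 'I_n, injective f /\ f @: [set: 'I_N] = S.
  rewrite -cardS; exists enum_val; split; first exact: enum_val_inj.
  apply/setP => v; apply/imsetP/idP => [[i _ ->]|vS]; first exact: enum_valP.
  by exists (enum_rank_in vS v); rewrite ?enum_rankK_in.
have /choice[fe feE] : forall e : edge N, exists e' : edge n, val e' = f @: val e.
  move=> e.
  have [u [v [uv ->]]] := edge_ends e.
  have fuv : f u != f v by rewrite (inj_eq finj).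
  by have [e' e'E] := edge_of_pair fuv; exists e'; rewrite e'E imsetU !imset_set1.
have feinj : injective fe.
  by move=> e e' /(congr1 val); rewrite !feE => /(imset_inj finj)/val_inj.
have feS e : val (fe e) \subset S by rewrite feE -fS imsetS.
set L := asked G r.
have feL e : fe e \in L by move/forallP: fullS => /(_ (fe e)); rewrite feS.
have /choice[rd rdP] : forall e : edge N, exists i,
    [/\ i < r, fe e \in query A (answers A G i) & fe e \notin asked G i].
  move=> e.
  have [i0 i0r ei0] := mem_asked _ _ _ (feL e).
  have ex : exists i, fe e \in query A (answers A G i) by exists i0.
  case: (ex_minnP ex) => i ei imin; exists i; split => //.
    by apply: leq_ltn_trans i0r; exact: imin.
  by apply/negP => /mem_asked[j ji /imin]; rewrite leqNgt ji.
have [m [mm cm mc]] := hlam (fun e => (rd e).+1) (fun e => let: And3 h _ _ := rdP e in h).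
have ltq e : index (fe e) L < q by apply: leq_trans Gq; rewrite -size_asked index_mem.
pose J := [set Ordinal (ltq e) | e in m]; pose W := S :\: f @: covered m.
exists J, W.
have JP k : reflect (exists2 e, e \in m & index (fe e) L = k) (positions J k).
  apply: (iffP exists_inP) => [[_ /imsetP[e em ->] /eqP <-]|[e em <-]]; first by exists e.
  by exists (Ordinal (ltq e)) => //; exact: imset_f.
have knownS t : t <= r -> known (positions J) W G t \subset S.
  move=> tr; rewrite subUset subsetDl; apply/bigcupsP => e; rewrite inE => /andP[et].
  case/JP => g gm; rewrite -(index_asked tr et) => gE.
  by rewrite -(index_inj_in (feL g) (@asked_sub G _ _ tr _ et) gE) feS.
split.
- rewrite card_in_imset // => e e' _ _ /(congr1 val) /= /index_inj_in h.
  by apply: feinj; exact: h.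
- rewrite cardsDS; last by rewrite -fS imsetS.
  by rewrite card_imset // card_covered // cm cardS.
- apply/subsetP => e /mem_settled[i ir]; rewrite inE => /and3P[_ _ ek].
  move/forallP: cliqueS => /(_ e); rewrite (subset_trans ek) //; exact: knownS.
apply: leq_trans (_ : #|fe @: (~: critical_set (fun e => (rd e).+1) m)| <= _).
  rewrite card_imset // -(leq_add2l #|critical_set (fun e => (rd e).+1) m|) cardsC.
  by rewrite card_edge.
apply/subset_leq_card/subsetP => _ /imsetP[e ecrit ->].
have [er eq ea] := rdP e; apply/mem_settled; exists (rd e) => //.
rewrite inE eq ea /=; apply/subsetP => x; rewrite feE => /imsetP[u ue ->].
rewrite !inE; have [um|um] := boolP (f u \in f @: covered m); last by rewrite -fS imset_f.
apply/orP; right; move: um; rewrite (mem_imset _ _ finj) => /coveredP[g gm ug].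
have ge : rd g <= rd e.
  rewrite leqNgt; apply/negP => eg; move: ecrit; rewrite inE => /negP; apply.
  by apply/critical_setP; exists g, u.
have [_ gq _] := rdP g.
have ga : fe g \in asked G (rd e).+1 by apply/mem_asked; exists (rd g).
apply/coveredP; exists (fe g); last by rewrite feE imset_f.
by rewrite inE ga; apply/JP; exists g => //; exact: index_asked.
Qed.

Lemma bin_le_exp a b : 'C(a, b) <= a ^ b.
Proof.
apply: leq_trans (_ : a ^_ b <= _); first by rewrite -bin_ffact leq_pmulr ?fact_gt0.
elim: b => [|b IH]; first by rewrite ffactn0.
by rewrite ffactnSr expnSr leq_mul // leq_subr.
Qed.

(** The union bound over the codes: each good graph has weight at least 2^T for
    one of them, while by [settled_weight] every code has total weight at most
    the number of graphs. *)
Lemma card_good_graphs (q N M T : nat) :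
  (forall G, num_queries A G <= q) ->
  (forall lam : edge N -> nat, (forall e : edge N, 1 <= lam e <= rounds A) ->
    exists m, [/\ matching m, #|m| = M & #|critical_set lam m| + T <= 'C(N, 2)]) ->
  #|good_graphs N| * 2 ^ T <= q ^ M * n ^ (N - 2 * M) * 2 ^ #|{: edge n}|.
Proof.
move=> Aq hlam.
pose codes := setX [set J : {set 'I_q} | #|J| == M] [set W : {set 'I_n} | #|W| == N - 2 * M].
pose F (c : {set 'I_q} * {set 'I_n}) G := settled (positions c.1) c.2 G (rounds A).
apply: leq_trans (_ : #|codes| * 2 ^ #|{: edge n}| <= _); last first.
  by rewrite leq_mul2r cardsX !card_draws !card_ord leq_mul ?orbT // bin_le_exp.
rewrite -!sum_nat_const.
apply: leq_trans (_ : \sum_(c in codes) \sum_(G | F c G \subset G) 2 ^ #|F c G| <= _); last first.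
  by apply: leq_sum => c _; exact: settled_weight.
under [leqRHS]eq_bigr => c _ do rewrite big_mkcond /=.
rewrite exchange_big /= big_mkcond /=; apply: leq_sum => G _; case: ifP => // Ggood.
have [J [W [cJ cW FG TF]]] := good_graph_code (Aq G) Ggood hlam.
rewrite (bigD1 (J, W)) /=; last by rewrite in_setX !inE cJ cW !eqxx.
by rewrite /F FG; apply: leq_trans (leq_addr _ _); rewrite leq_exp2l.
Qed.

End Process.

(** * The first moment bound *)

Section Asymptotics.
Local Open Scope ring_scope.
Variable R : realType.

Lemma natr_bin2 (N : nat) : ('C(N, 2)%:R : R) = N%:R * (N%:R - 1) / 2.
Proof.
have h : ('C(N, 2) * 2 = N * N.-1)%N by rewrite bin2 muln2 halfK oddM; case: N => //= N; rewrite andNb subn0.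
have : ('C(N, 2)%:R * 2 : R) = (N * N.-1)%:R by rewrite -h natrM.
case: N {h} => [|N]; first by rewrite bin0n !mul0r.
by rewrite -[N.+1.-1]/N natrM -[N.+1%:R]natr1 addrK => <-; rewrite mulfK // pnatr_eq0.
Qed.

Lemma gnp_prob_half n (E : pred {set edge n}) :
  gnp_prob (2^-1 : R) E * 2 ^+ #|{: edge n}| = #|[set G | E G]%SET|%:R.
Proof.
rewrite /gnp_prob big_distrl /= (eq_bigr (fun=> 1)) => [|G _].
  by rewrite sumr_const; congr _%:R; apply: eq_card => G; rewrite inE.
rewrite (eq_bigr (fun=> 2^-1)) => [|e _]; last by case: ifP => // _; lra.
by rewrite prodr_const -exprMn mulVf ?expr1n // pnatr_eq0.
Qed.

(** At least half of the graphs with an unqueried pair in the output are failures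
    ([unqueried_half]), so the success probability is at most (1 + p) / 2, where
    p is the probability of a good graph. *)
Lemma card_success_le n (A : algorithm n) (P : pred {set edge n}) (N : nat) :
  (forall G, P G -> is_clique G (result A G) /\ #|result A G| = N) ->
  (2 * #|[set G | P G]%SET| <= #|good_graphs A N| + 2 ^ #|{: edge n}|)%N.
Proof.
move=> hP; set U := [set G : {set edge n} | is_clique G (result A G) && ~~ fully_queried A G]%SET.
set V := [set G : {set edge n} | ~~ fully_queried A G]%SET.
have PU : [set G | P G]%SET \subset good_graphs A N :|: U.
  apply/subsetP => G; rewrite !inE => /hP[-> ->]; rewrite eqxx andbT /=.
  by case: fully_queried.
have GV : [disjoint good_graphs A N & V].
  rewrite disjoint_subset; apply/subsetP => G; rewrite !inE => /and3P[_ -> _].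
  by [].
have h1 : (#|[set G | P G]%SET| <= #|good_graphs A N| + #|U|)%N.
  apply: leq_trans (subset_leq_card PU) _.
  by have [] := leq_card_setU (good_graphs A N) U.
have h2 := unqueried_half A.
have h3 : (#|good_graphs A N| + #|V| <= 2 ^ #|{: edge n}|)%N.
  have [_] := leq_card_setU (good_graphs A N) V; rewrite GV => /eqP <-.
  have -> : (2 ^ #|{: edge n}| = #|{: {set edge n}}|)%N.
    by rewrite -[RHS]cardsT -powersetT card_powerset cardsT.
  exact: max_card.
rewrite -/U -/V in h2; move: h1 h2 h3.
move: #|[set G | P G]%SET| #|good_graphs A N| #|U| #|V| (2 ^ _)%N => a b c d k; clear; lia.
Qed.

(** For L = log n, N close to alpha L and M close to mu L, the right side of the
    conclusion exceeds the left side by L^2 times the parenthesis in the last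
    hypothesis, up to terms linear in L.  That hypothesis says that L is large
    enough for the leading term to absorb the linear ones. *)
Lemma exponent_gap (alpha mu g x L N M : R) :
  0 < alpha -> 0 <= g -> 0 <= x ->
  mu * L - 1 <= M <= mu * L -> alpha * L - 1 <= N <= alpha * L ->
  0 <= M -> 2 <= alpha * L ->
  x + 3 * alpha / 2 <= L * (alpha ^+ 2 / 2 - alpha - 2 * g * mu ^+ 2 + x * mu) ->
  L * (N - x * M) + 1 <= N * (N - 1) / 2 - g * (M * (2 * M - 1)).
Proof.
move=> a0 g0 x0 /andP[M1 M2] /andP[N1 N2] M0 aL hL.
have L0 : 0 <= L by rewrite -(pmulr_rge0 _ a0); lra.
have e1 : (alpha * L - 1) * (alpha * L - 2) <= N * (N - 1) by nra.
have e2 : g * (M * (2 * M - 1)) <= 2 * g * (mu * L) ^+ 2.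
  have : M * (2 * M - 1) <= 2 * (mu * L) ^+ 2 by nra.
  by move=> /(ler_wpM2l g0); nra.
have e3 : L * x * (mu * L - 1) <= L * x * M by apply: ler_wpM2l => //; exact: mulr_ge0.
have e4 : L * N <= L * (alpha * L) by exact: ler_wpM2l.
have e5 := ler_wpM2l L0 hL.
nra.
Qed.

Lemma log2_large (x : R) : exists n0, forall n, (n0 <= n)%N -> (0 < n)%N /\ x <= log2 (n%:R : R).
Proof.
have l2 : 0 < ln (2 : R) by rewrite ln_gt0 ?ltr1n.
exists (Num.truncn (expR (x * ln 2))).+1 => n hn; split; first exact: leq_trans hn.
rewrite ler_pdivlMr // -ler_expR lnK ?posrE ?ltr0n; last exact: leq_trans hn.
by apply: le_trans (ltW (truncnS_gt _)) _; rewrite ler_nat.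
Qed.

(** The gap hypothesis says that the number of codes, at most
    n^(delta M + N - 2 M), is at most half of 2^T, where T bounds the number
    of noncritical pairs from below.  Good graphs then have probability at most 1/2, and
    successes at most 3/4. *)
Lemma success_bound n (A : algorithm n) (delta alpha g : R) (N M : nat) :
  (0 < n)%N -> 0 <= delta ->
  (forall G, (num_queries A G)%:R <= (n%:R : R) `^ delta) ->
  0 <= alpha * log2 (n%:R : R) -> N = Num.truncn (alpha * log2 (n%:R : R)) ->
  (2 * M <= N)%N -> 0 <= g ->
  (forall lam : edge N -> nat, (forall e : edge N, (1 <= lam e <= rounds A)%N) ->
    exists m, [/\ matching m, #|m| = M & #|critical_set lam m|%:R <= g * 'C(2 * M, 2)%:R]) ->
  log2 (n%:R : R) * (N%:R - (2 - delta) * M%:R) + 1 <=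
    N%:R * (N%:R - 1) / 2 - g * (M%:R * (2 * M%:R - 1)) ->
  gnp_prob (2^-1 : R) (finds_clique alpha A) <= 3 / 4.
Proof.
move=> n0 d0 Aq aL NE MN g0 hlam gap.
set K := g * 'C(2 * M, 2)%:R in hlam.
have K0 : 0 <= K by rewrite mulr_ge0.
set q := Num.truncn ((n%:R : R) `^ delta).
(* T bounds the number of noncritical pairs from below; if K exceeds the number
   of pairs, then T = 0 and the bound is trivial. *)
pose T := ('C(N, 2) - Num.truncn K)%N.
have qd : q%:R <= (n%:R : R) `^ delta by rewrite truncn_le powR_ge0.
have hq G : (num_queries A G <= q)%N.
  by rewrite -(ler_nat R) /q; move: (Aq G); rewrite -truncn_ge_nat ?powR_ge0 // ler_nat.
have hT (lam : edge N -> nat) : (forall e : edge N, (1 <= lam e <= rounds A)%N) ->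
    exists m, [/\ matching m, #|m| = M & (#|critical_set lam m| + T <= 'C(N, 2))%N].
  move=> /hlam[m [mm cm mc]]; exists m; split => //.
  have c1 : (#|critical_set lam m| <= Num.truncn K)%N by rewrite truncn_ge_nat.
  have c2 : (#|critical_set lam m| <= 'C(N, 2))%N by rewrite -card_edge max_card.
  by rewrite /T; move: c1 c2; move: #|critical_set _ _| (Num.truncn K) 'C(N, 2); clear; lia.
have := card_good_graphs hq hT; set E := #|{: edge n}| => hgood.
have hsucc : (2 * #|[set G | finds_clique alpha A G]%SET| <= #|good_graphs A N| + 2 ^ E)%N.
  apply: card_success_le => G /andP[h1 /eqP h2]; split => //.
  by move: h2; rewrite -[Num.floor _]gez0_abs ?floor_ge0 // NE truncn_floor aL => -[].
have := gnp_prob_half (finds_clique alpha A); rewrite -/E => hp.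
have E0 : 0 < (2 : R) ^+ E by rewrite exprn_gt0.
rewrite -(ler_pM2r E0) hp.
suff hg : (2 * #|good_graphs A N|)%:R <= (2 : R) ^+ E.
  move: hsucc hg; rewrite -(ler_nat R) natrD natrX !natrM.
  have aux (a b k : R) : 2 * a <= b + k -> 2 * b <= k -> a <= 3 / 4 * k by clear; lra.
  exact: aux.
set L := log2 _ in gap.
have l2 : 0 < ln (2 : R) by rewrite ln_gt0 ?ltr1n.
have lnn : ln (n%:R : R) = L * ln 2 by rewrite /L /log2 divfK // gt_eqF.
have nE : (n%:R : R) = expR (L * ln 2) by rewrite -lnn lnK // posrE ltr0n.
have E2 : (2 : R) = expR (ln 2) by rewrite lnK // posrE.
have CN : ('C(N, 2)%:R : R) = N%:R * (N%:R - 1) / 2.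
  by rewrite natr_bin2.
have TK : N%:R * (N%:R - 1) / 2 - g * (M%:R * (2 * M%:R - 1)) <= T%:R :> R.
  rewrite lerBlDr; apply: le_trans (_ : T%:R + (Num.truncn K)%:R <= _).
    by rewrite -natr_bin2 -natrD ler_nat /T addnC -leq_subLR.
  rewrite lerD2l; apply: le_trans (_ : K <= _); first by rewrite truncn_le.
  by rewrite /K natr_bin2 natrM le_eqVlt; apply/orP; left; apply/eqP; field.
have codes : 2 * ((q ^ M * n ^ (N - 2 * M))%N%:R) <= (2 : R) ^+ T.
  apply: (@le_trans _ _ (2 * (((n%:R : R) `^ delta) ^+ M * n%:R ^+ (N - 2 * M)))).
    rewrite natrM !natrX; apply: ler_wpM2l => //; apply: ler_wpM2r; first exact: exprn_ge0.
    by apply: lerXn2r; rewrite ?nnegrE ?powR_ge0.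
  have p1 : ((n%:R : R) `^ delta) ^+ M = expR (M%:R * (delta * (L * ln 2))).
    by rewrite /powR pnatr_eq0 gtn_eqF // lnn expRM_natl.
  have p2 : (n%:R : R) ^+ (N - 2 * M) = expR ((N%:R - 2 * M%:R) * (L * ln 2)).
    by rewrite [in LHS]nE -expRM_natl natrB // natrM.
  have p3 : (2 : R) ^+ T = expR (T%:R * ln 2) by rewrite [in LHS]E2 -expRM_natl.
  rewrite p1 p2 p3 [X in X * _]E2 -!expRD ler_expR.
  have -> : ln 2 + (M%:R * (delta * (L * ln 2)) + (N%:R - 2 * M%:R) * (L * ln 2)) =
      (L * (N%:R - (2 - delta) * M%:R) + 1) * ln (2 : R) by ring.
  by rewrite ler_pM2r //; apply: le_trans gap TK.
have := hgood; rewrite -(ler_nat R) !natrM !natrX => h.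
have T0 : 0 < (2 : R) ^+ T by rewrite exprn_gt0.
rewrite -(ler_pM2r T0) -mulrA; apply: (@le_trans _ _ (2 * (q ^ M * n ^ (N - 2 * M))%:R * 2 ^+ E)).
  by rewrite natrM !natrX -mulrA; apply: ler_wpM2l.
by rewrite mulrC; apply: ler_wpM2l => //; exact: ltW.
Qed.

End Asymptotics.

(** * From the quadratic inequality to the bounds on alpha *)

Section Main.
Local Open Scope ring_scope.
Variable R : realType.

(** Were the quadratic expression positive, N = alpha log n and M = mu log n,
    rounded down, would satisfy the gap hypothesis of [success_bound] for all
    large n, and the success probability would stay below 3/4. *)
Lemma achievable_quadratic_lt (delta alpha mu g : R) l :
  le_enat 1 l -> 0 <= delta <= 2 -> achievable delta l alpha ->
  0 < mu -> 2 * mu < alpha -> 0 <= g -> gamma R l < g ->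
  alpha ^+ 2 / 2 - alpha - 2 * g * mu ^+ 2 + (2 - delta) * mu <= 0.
Proof.
move=> l1 /andP[d0 d2] [A [Ar Aq Acvg]] mu0 mua g0 gg.
set c := (X in X <= 0); rewrite leNgt; apply/negP => c0.
have a0 : 0 < alpha by apply: lt_trans mua; rewrite mulr_gt0.
have [M0 hM0] := gamma_matching l1 gg.
have [n1 hn1] := log2_large (Num.max (Num.max (2 / alpha) ((2 - delta + 3 * alpha / 2) / c))
                  ((M0%:R + 1) / mu)).
have [n2 _ hn2] : \forall n \near \oo%classic, 3 / 4 < gnp_prob (2^-1 : R) (finds_clique alpha (A n)).
  by apply: (cvgr_gt 1 Acvg); lra.
pose n := maxn n1 n2.
have [n0] := hn1 n (leq_maxl _ _); set L := log2 _.
(* The three bounds on L make, in this order, alpha L >= 2, the leading term of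
   the gap dominant, and M >= M0. *)
rewrite !ge_max => /andP[/andP[L1 L2] L3].
have := hn2 n (leq_maxr _ _); rewrite ltNge => /negP; apply.
rewrite ler_pdivrMr // mulrC in L1; rewrite ler_pdivrMr // in L2.
rewrite ler_pdivrMr // mulrC in L3.
have aL : 0 <= alpha * L by apply: le_trans L1.
have muL : 0 <= mu * L by apply: le_trans L3; rewrite addr_ge0.
pose N := Num.truncn (alpha * L); pose M := Num.truncn (mu * L).
have Nle : N%:R <= alpha * L by rewrite truncn_le.
have Nge : alpha * L - 1 < N%:R by rewrite ltrBlDr natr1 truncnS_gt.
have Mle : M%:R <= mu * L by rewrite truncn_le.
have Mge : mu * L - 1 < M%:R by rewrite ltrBlDr natr1 truncnS_gt.
have MN : (2 * M <= N)%N.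
  rewrite truncn_ge_nat // natrM; apply: (@le_trans _ _ (2 * (mu * L))).
    by apply: ler_wpM2l.
  by rewrite mulrA; apply: ler_wpM2r (ltW mua); rewrite -(pmulr_rge0 _ mu0).
have M0M : (M0 <= M)%N by rewrite truncn_ge_nat //; apply: le_trans L3; rewrite lerDl.
apply: (success_bound n0 d0 (Aq n) aL erefl MN g0).
  move=> lam hlam; apply: (hM0 M N lam M0M MN) => e.
  have /andP[-> h] := hlam e; split => //.
  by move: (Ar n); case: (l) => //= b; exact: leq_trans h.
apply: (@exponent_gap _ alpha mu) => //.
- by rewrite subr_ge0.
- by rewrite (ltW Mge) Mle.
- by rewrite (ltW Nge) Nle.
Qed.

(** The restriction to strictly larger values g of gamma is removed by letting g
    decrease to gamma. *)
Lemma achievable_quadratic (delta alpha mu : R) l :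
  le_enat 1 l -> 0 <= delta <= 2 -> achievable delta l alpha ->
  0 < mu -> 2 * mu < alpha ->
  alpha ^+ 2 / 2 - alpha - 2 * gamma R l * mu ^+ 2 + (2 - delta) * mu <= 0.
Proof.
move=> l1 d02 ach mu0 mua; apply/ler_addgt0Pl => e e0; rewrite addr0.
have mu2 : 0 < 2 * mu ^+ 2 by rewrite mulr_gt0 // exprn_gt0.
have g0 : 0 <= gamma R l by have := @gamma_ge R l 0 l1; rewrite mul0r.
have := @achievable_quadratic_lt delta alpha mu (gamma R l + e / (2 * mu ^+ 2)) l l1 d02 ach mu0 mua.
have e' : 0 < e / (2 * mu ^+ 2) by rewrite divr_gt0.
rewrite ltrDl addr_ge0 ?(ltW e') // => /(_ isT e').
have -> : 2 * (gamma R l + e / (2 * mu ^+ 2)) * mu ^+ 2 = 2 * gamma R l * mu ^+ 2 + e.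
  by field; rewrite gt_eqF.
by lra.
Qed.

(** Instead of a limit: on the segment from t to the midpoint, concavity bounds
    the polynomial from below by linear interpolation, so a positive value at t
    would persist at nearby interior points. *)
Lemma concave_quadratic_closure (p0 p1 p2 a b : R) : 0 <= p2 -> a < b ->
  (forall t, a < t < b -> p0 + p1 * t - p2 * t ^+ 2 <= 0) ->
  forall t, a <= t <= b -> p0 + p1 * t - p2 * t ^+ 2 <= 0.
Proof.
move=> p20 ab hp t /andP[ta tb].
pose p u := p0 + p1 * u - p2 * u ^+ 2; pose c := (a + b) / 2.
have pc : p c <= 0 by apply: hp; rewrite /c; apply/andP; split; lra.
rewrite -/(p t) leNgt; apply/negP => pt.
pose s := p t / (2 * (p t - p c)).
have D0 : 0 < p t - p c by lra.
have s0 : 0 < s by rewrite divr_gt0 // mulr_gt0.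
have s1 : s < 1 by rewrite ltr_pdivrMr ?mulr_gt0 // mul1r; lra.
have sE : s * (p t - p c) = p t / 2 by rewrite /s; field; rewrite gt_eqF.
have : p (t + s * (c - t)) <= 0.
  by apply: hp; rewrite /c; apply/andP; split; nra.
have -> : p (t + s * (c - t)) =
    p t - s * (p t - p c) + p2 * (s * (1 - s)) * (c - t) ^+ 2 by rewrite /p; ring.
have : 0 <= p2 * (s * (1 - s)) * (c - t) ^+ 2.
  rewrite mulr_ge0 ?sqr_ge0 // mulr_ge0 // mulr_ge0 ?(ltW s0) //.
  by rewrite subr_ge0 ltW.
by rewrite sE; lra.
Qed.

(** The end points matter: mu = 0 gives the first moment bound alpha <= 2 when
    delta = 2, and mu = alpha / 2 the bound for two rounds and small delta. *)
Lemma achievable_quadratic_closed (delta alpha mu : R) l :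
  le_enat 1 l -> 0 <= delta <= 2 -> achievable delta l alpha ->
  0 < alpha -> 0 <= mu -> 2 * mu <= alpha ->
  alpha ^+ 2 / 2 - alpha - 2 * gamma R l * mu ^+ 2 + (2 - delta) * mu <= 0.
Proof.
move=> l1 d02 ach a0 mu0 mua; rewrite addrAC.
have g0 : 0 <= gamma R l by have := @gamma_ge R l 0 l1; rewrite mul0r.
apply: (@concave_quadratic_closure _ _ _ 0 (alpha / 2)).
- by rewrite mulr_ge0.
- by rewrite divr_gt0.
- move=> t /andP[t0 ta]; rewrite addrAC; apply: achievable_quadratic => //; lra.
- by rewrite mu0 /=; lra.
Qed.

(** At the maximizer mu = (2 - delta) / (4 gamma) the quadratic inequality reads
    (alpha - 1)^2 <= 1 - (2 - delta)^2 / (4 gamma).  The last hypothesis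
    guarantees that the maximizer is at most alpha / 2 as soon as alpha exceeds
    the claimed bound. *)
Lemma achievable_le_vertex (delta alpha : R) l :
  le_enat 1 l -> 1 <= delta <= 2 -> achievable delta l alpha ->
  0 < gamma R l -> (2 - delta) / (2 * gamma R l) + (2 - delta) / 2 <= 2 ->
  alpha <= 1 + Num.sqrt (1 - (2 - delta) ^+ 2 / (4 * gamma R l)).
Proof.
move=> l1 /andP[d1 d2] ach g0 hx.
set g := gamma R l in g0 hx *; set x := 2 - delta in hx *.
have x0 : 0 <= x by rewrite /x subr_ge0.
have x1 : x <= 1 by rewrite /x; lra.
have d02 : 0 <= delta <= 2 by rewrite d2 andbT; lra.
set y := x / (2 * g) in hx.
have -> : x ^+ 2 / (4 * g) = x * y / 2 by rewrite /y; field; rewrite gt_eqF.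
set s := Num.sqrt _; rewrite leNgt; apply/negP => as0.
have s0 : 0 <= s by exact: sqrtr_ge0.
have y0 : 0 <= y by rewrite divr_ge0 // mulr_ge0 // ltW.
have ss : 1 - x * y / 2 <= s ^+ 2.
  have [h|h] := leP 0 (1 - x * y / 2); first by rewrite sqr_sqrtr.
  by apply: le_trans (ltW h) _; exact: sqr_ge0.
(* This is 2 mu <= alpha for the maximizer mu = y / 2. *)
have sy : y <= 1 + s.
  rewrite leNgt; apply/negP => sy; nra.
have quad : (alpha - 1) ^+ 2 <= 1 - x * y / 2.
  have a0 : 0 < alpha by lra.
  have := @achievable_quadratic_closed delta alpha (y / 2) l l1 d02 ach a0.
  have -> : 2 * gamma R l * (y / 2) ^+ 2 = x * y / 4.
    by rewrite -/g /y; field; rewrite gt_eqF.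
  by rewrite -/x; lra.
have : s < alpha - 1 by lra.
nra.
Qed.

Lemma alpha_star_le (delta B : R) l :
  (forall alpha, achievable delta l alpha -> alpha <= B) -> (alpha_star delta l <= B%:E)%E.
Proof. by move=> h; apply: ge_ereal_sup => _ [alpha /h ? <-]; rewrite lee_fin. Qed.

Lemma vertex_condition_mono (x g c : R) : 0 <= x -> 0 < c -> c <= g -> x / (2 * c) + x / 2 <= 2 ->
  x / (2 * g) + x / 2 <= 2.
Proof.
move=> x0 c0 cg; apply: le_trans; rewrite lerD2r; apply: ler_wpM2l => //.
by rewrite lef_pV2 ?posrE ?mulr_gt0 // ?(lt_le_trans c0) // ler_pM2l.
Qed.

End Main.

Local Open Scope ring_scope.

Theorem theorem1 (R : realType) :
  (forall (delta : R) (l : enat), 1 <= delta <= 2 -> le_enat 3 l ->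
     (alpha_star delta l <=
       (1 + Num.sqrt (1 - (2 - delta) ^+ 2 / (4 * gamma R l)))%:E)%E) /\
  (forall delta : R, 6 / 5 <= delta <= 2 ->
     (alpha_star delta (Some 2%N) <=
       (1 + Num.sqrt (1 - (2 - delta) ^+ 2 / (4 * gamma R (Some 2%N))))%:E)%E) /\
  (forall delta : R, 1 <= delta <= 6 / 5 ->
     (alpha_star delta (Some 2%N) <= (4 * delta / 3)%:E)%E).
Proof.
have g3 l : le_enat 3 l -> 1 / 3 <= gamma R l.
  by move=> l3; have := @gamma_ge R l 2 l3; apply: le_trans; lra.
have g2 : 1 / 4 <= gamma R (Some 2%N).
  by have := @gamma_ge R (Some 2%N) 1 isT; apply: le_trans; lra.
(* The condition on the vertex holds for 2 - delta <= 1 when gamma >= 1/3, but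
   only for 2 - delta <= 4/5 when gamma >= 1/4. *)
split=> [delta l d12 l3|].
  apply: alpha_star_le => alpha ach; apply: achievable_le_vertex => //.
  - by case: l l3 {ach} => //= l; apply: leq_trans.
  - by apply: lt_le_trans (g3 l l3).
  - by apply: (vertex_condition_mono (c := 1 / 3)) => //; [lra|exact: g3|lra].
split=> delta d12; apply: alpha_star_le => alpha ach.
  apply: achievable_le_vertex => //; first by lra.
    exact: lt_le_trans g2.
  by apply: (vertex_condition_mono (c := 1 / 4)) => //; lra.
rewrite leNgt; apply/negP => h.
have a0 : 0 < alpha by lra.
have := @achievable_quadratic_closed R delta alpha (alpha / 2) (Some 2%N) isT.
have d02 : 0 <= delta <= 2 by lra.
move=> /(_ d02 ach a0); have g2' := gamma2_le R.
have a20 : 0 <= alpha / 2 by lra.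
have aa : 2 * (alpha / 2) <= alpha by lra.
move=> /(_ a20 aa).
nra.
Qed.
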